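(* As $n\to\infty$, $$L(n,0) \asymp \frac{n2^n}{\log_2 n},$$ that is, there exist constants $c_1,c_2>0$ and $n_0\in\mathbb{N}$ such that $c_1\, n2^n/\log_2 n \le L(n,0)\le c_2\, n2^n/\log_2 n$ for all $n>n_0$.
   Context: For $n\ge 1$, $j\in\{1,\dots,n\}$ and $I \subseteq \{1,\dots,n\}\setminus\{j\}$, the gate $TOF(I;j)$ on $n$ inputs defines the transformation $\mathbb{Z}_2^n \to \mathbb{Z}_2^n$ that replaces $x_j$ by $x_j \oplus \bigwedge_{i\in I} x_i$ and leaves all other coordinates unchanged; for $I=\emptyset$ it is the NOT gate $x_j \mapsto x_j\oplus 1$. Let $\Omega_n^2$ be the set of all gates $TOF(I;j)$ on $n$ inputs with $|I|\le 2$ (NOT, CNOT and 2-CNOT gates). A reversible circuit $\mathfrak{S}$ with $n$ inputs is a finite sequence (composition) of $l\ge 0$ gates from $\Omega_n^2$, applied one after another; it defines a transformation $g:\mathbb{Z}_2^n\to\mathbb{Z}_2^n$. Its gate complexity is $L(\mathfrak{S}) = l$. A reversible circuit with $n$ inputs defining $g$ implements $f:\mathbb{Z}_2^n\to\mathbb{Z}_2^n$ without additional inputs if there is a permutation $\pi$ of $\{1,\dots,n\}$ such that for every $x\in\mathbb{Z}_2^n$, writing $g(x) = (y_1,\dots,y_n)$, one has $f(x) = (y_{\pi(1)},\dots,y_{\pi(n)})$. $F(n,0)$ is the set of all transformations $\mathbb{Z}_2^n\to\mathbb{Z}_2^n$ that can be implemented in this way by reversible circuits with $n$ inputs (gates from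 $\Omega_n^2$). For $f\in F(n,0)$, $L(f,0)$ is the minimum of $L(\mathfrak{S})$ over all circuits $\mathfrak{S}$ of gates from $\Omega_n^2$ implementing $f$ without additional inputs, and $L(n,0) = \max_{f\in F(n,0)} L(f,0)$. *)

(* Defs.v *)
From mathcomp Require Import all_boot all_order all_algebra perm.
From mathcomp Require Import boolp reals exp.

Set Implicit Arguments.
Unset Strict Implicit.
Unset Printing Implicit Defensive.

(* Z_2^n as boolean vectors: addition is [addb], product is [andb];
   coordinates are numbered from 0. *)
Notation Z2 n := {ffun 'I_n -> bool}.

(* The pair (I, j) stands for TOF(I; j); the conditions j \notin I and
   #|I| <= 2 are imposed by [Omega2]. *)
Notation gate n := ({set 'I_n} * 'I_n)%type.

(* For I = set0 the conjunction is [true], so the gate is NOT. *)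
Definition TOF n (I : {set 'I_n}) (j : 'I_n) (x : Z2 n) : Z2 n :=
  [ffun k => if k == j then x j (+) [forall i in I, x i] else x k].

Definition Omega2 (n : nat) : {set gate n} :=
  [set g : gate n | (g.2 \notin g.1) && (#|g.1| <= 2)].

Definition is_circuit n (S : seq (gate n)) : bool := all [in Omega2 n] S.

(* The head of the sequence acts first. *)
Definition run n (S : seq (gate n)) (x : Z2 n) : Z2 n :=
  foldl (fun y g => TOF g.1 g.2 y) x S.

Definition implements n (S : seq (gate n)) (f : {ffun Z2 n -> Z2 n}) : bool :=
  [exists p : 'S_n, forall x, f x == [ffun i => run S x (p i)]].

(* The 0 in [F0 n], [Lf0 f] and [L0 n], which are F(n,0), L(f,0) and L(n,0),
   is the number of additional inputs. *)
Definition F0 (n : nat) : {set {ffun Z2 n -> Z2 n}} :=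
  [set f | `[< exists S : seq (gate n), is_circuit S && implements S f >]].

Definition has_circuit_of_size n (f : {ffun Z2 n -> Z2 n}) (l : nat) : bool :=
  [exists S : l.-tuple (gate n), is_circuit S && implements S f].

(* The value 0 outside [F0 n] is a dummy. *)
Definition Lf0 n (f : {ffun Z2 n -> Z2 n}) : nat :=
  if pselect (exists l, has_circuit_of_size f l) is left h then ex_minn h else 0.

Definition L0 (n : nat) : nat := \max_(f in F0 n) Lf0 f.

Lemma Lf0_min n (f : {ffun Z2 n -> Z2 n}) : f \in F0 n ->
  (exists S, [/\ is_circuit S, implements S f & size S = Lf0 f]) /\
  (forall S, is_circuit S -> implements S f -> Lf0 f <= size S).
Proof.
have sizeP S : is_circuit S && implements S f -> has_circuit_of_size f (size S).
  by move=> SP; apply/existsP; exists (in_tuple S).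
rewrite inE => /asboolP[S0 /sizeP hS0].
rewrite /Lf0; case: pselect => [h|[]]; last by exists (size S0).
case: ex_minnP => m /existsP[S /andP[cS iS]] minm; split.
  by exists S; rewrite size_tuple.
by move=> S' c' i'; apply/minm/sizeP/andP.
Qed.

Local Open Scope ring_scope.

Definition log2 (R : realType) (x : R) : R := ln x / ln 2.

(* Main.v *)
(* A gate count bounds the number of circuits of length at most [L] by
   [n! * (n ^ 3 + 1) ^ L], while every even permutation is realized: this gives
   the lower bound.

   Conversely a circuit realizes an even permutation up to a reordering of the
   outputs.  An even permutation [g] is written as a product of about [2 ^ n / K]
   involutions, each of them a product of [K] disjoint transpositions, where [K]
   is of order [log n]: as long as [g] moves at least [3 * K] points, choose
   disjoint pairs [(y, g y)]; the few remaining transpositions are taken two by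
   two and padded with a common involution.  Each involution costs [O(n)] gates:
   viewing its [2 * K] points as the rows of a matrix with [n] columns, at most
   [2 ^ (2 * K)] columns are distinct, so [n] CNOT gates clear all columns but
   these; the few remaining wires are then recoded at cost [O(n)] so that the
   points fill a subcube, on which the involution is a single multiply controlled
   NOT, of linear cost since a wire of the subcube is left as a dirty wire. *)
Require Import Defs.
From mathcomp Require Import all_boot all_order all_algebra perm.
From mathcomp Require Import fingroup alt.
From mathcomp Require Import boolp reals exp.
From mathcomp Require Import zify lra.

Set Implicit Arguments.
Unset Strict Implicit.
Unset Printing Implicit Defensive.

(* [lia] does not identify convertible occurrences of the same cardinal. *)
Ltac card_lia :=
  repeat match goal with H : context [#|_|] |- _ => move: H end;
  repeat match goal with |- context [#|?A|] => move: #|A| => ? end; lia.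

(** * Permutations as products of swaps *)

Section Swaps.

Variables (J T : finType).
Implicit Types (x : J * bool -> T) (g s : {perm T}).

(** For injective [x], this is the product of the [#|J|] disjoint transpositions of [x (i, false)]
    with [x (i, true)]. *)
Definition is_swap x s : Prop :=
  (forall i b, s (x (i, b)) = x (i, ~~ b)) /\
  (forall y, (forall i, y != x i) -> s y = y).

Definition moved g : {set T} := [set y | g y != y].

(** Greedy choice: [r] chosen points, their images and their preimages exclude at most [3 * r]
    points, so another moved point remains. *)
Lemma moved_disjoint r g : 3 * r <= #|moved g| ->
  exists s : seq T, [/\ size s = r, uniq (s ++ map g s) & {subset s <= moved g}].
Proof.
elim: r => [|r IH] rg; first by exists [::].
have [|s [ss us sg]] := IH.
  by apply: leq_trans rg; rewrite leq_mul2l leqnSn orbT.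
have /subsetPn[y yg] : ~~ (moved g \subset s ++ map g s ++ map (g^-1)%g s).
  apply/negP => /subset_leq_card; apply/negP; rewrite -ltnNge.
  apply: (leq_ltn_trans (card_size _)); apply: leq_trans rg.
  by rewrite !size_cat !size_map ss; lia.
rewrite !mem_cat !negb_or => /and3P[ys ygs ys'].
exists (y :: s); split=> /=; first by rewrite ss.
  move: us; rewrite cat_uniq => /and3P[us hs ugs].
  rewrite mem_cat inE !negb_or ys ygs; move: (yg); rewrite inE eq_sym => ->.
  rewrite cat_uniq us /= ugs (mem_map perm_inj) ys andbT /=.
  rewrite negb_or hs !andbT; apply: contra ys' => gys.
  by apply/mapP; exists (g y); rewrite ?permK.
by move=> z; rewrite inE => /predU1P[->|/sg].
Qed.

(** Pairing [u] with [g u] makes each chosen [u] a fixed point of [g * s], and no fixed point of [g]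
    is touched by [s]. *)
Lemma moved_swap g : 0 < #|J| -> 3 * #|J| <= #|moved g| ->
  exists2 x, injective x &
    forall s, is_swap x s -> #|moved (g * s)%g| + #|J| <= #|moved g|.
Proof.
move=> J0 Jg; have [s [ss us sg]] := moved_disjoint Jg.
have /card_gt0P[y0 _] : 0 < #|moved g| by lia.
pose u (i : J) := nth y0 s (enum_rank i).
have us_ i : u i \in s by rewrite mem_nth // ss ltn_ord.
move: us; rewrite cat_uniq => /and3P[us hs _].
have uI : injective u.
  move=> i i' /eqP; rewrite nth_uniq ?ss ?ltn_ord //.
  by move=> /eqP/val_inj/enum_rank_inj.
have ug i i' : u i != g (u i').
  apply: contraNneq hs => e; apply/hasP; exists (u i) => //=.
  by rewrite e map_f.
pose x (i : J * bool) := if i.2 then g (u i.1) else u i.1.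
exists x.
  move=> [i []] [i' []]; rewrite /x /=.
  - by move=> /perm_inj/uI ->.
  - by move=> e; move: (ug i' i); rewrite e eqxx.
  - by move=> e; move: (ug i i'); rewrite e eqxx.
  - by move=> /uI ->.
move=> t [tx tn].
have im : [set u i | i : J] \subset moved g.
  by apply/subsetP => _ /imsetP[i _ ->]; apply: sg.
rewrite -(cardsID [set u i | i : J] (moved g)) (setIidPr im) card_imset //.
rewrite addnC leq_add2l subset_leq_card //; apply/subsetP => y.
rewrite !inE permM => ty; apply/andP; split.
  apply: contra ty => /imsetP[i _ ->].
  by rewrite (_ : g (u i) = x (i, true)) // tx.
apply: contra ty => /eqP gy; rewrite gy tn // => -[i b].
apply/eqP => e; have := sg _ (us_ i); rewrite inE.
move: e gy; rewrite /x; case: b => /= -> gy; last by rewrite gy eqxx.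
by rewrite (perm_inj gy) eqxx.
Qed.

(* The transpositions common to both swaps cancel. *)
Lemma is_swap_tperm x x' s s' i0 : injective x -> injective x' ->
    (forall i b, i != i0 -> x' (i, b) = x (i, b)) ->
    is_swap x s -> is_swap x' s' ->
  (s * s')%g = (tperm (x (i0, false)) (x (i0, true)) *
                tperm (x' (i0, false)) (x' (i0, true)))%g.
Proof.
move=> xI xI' xx' [sx sn] [sx' sn'].
(* Off the pairs of index other than [i0], a swap acts as its transposition at [i0]. *)
have tE (y : J * bool -> T) t z : injective y -> is_swap y t ->
    (forall i b, i != i0 -> z != y (i, b)) ->
    t z = tperm (y (i0, false)) (y (i0, true)) z.
  move=> yI [ty tn] zy; case: tpermP => [->|->|/eqP z0 /eqP z1]; rewrite ?ty //.
  apply: tn => -[i b]; have [->|/zy//] := eqVneq i i0.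
  by case: b.
apply/permP => z; rewrite !permM.
have [/existsP[[i b] /andP[/= i0i /eqP->]]|] :=
  boolP [exists i : J * bool, (i.1 != i0) && (z == x i)].
  have e b' : x' (i, b') = x (i, b') by apply: xx'.
  have d b' b'' : x (i0, b') != x (i, b'').
    by rewrite (inj_eq xI) xpair_eqE eq_sym (negbTE i0i).
  have d' b' b'' : x' (i0, b') != x' (i, b'').
    by rewrite (inj_eq xI') xpair_eqE eq_sym (negbTE i0i).
  by rewrite sx -e sx' negbK (@tpermD _ (x (i0, _))) -?e ?tpermD // e.
rewrite negb_exists => /forallP zx.
have {}zx i b : i != i0 -> z != x (i, b) by move=> h; have := zx (i, b); rewrite /= h.
rewrite (tE x s z) //; apply: (tE x') => // i b ii0; rewrite xx' //.
case: tpermP => [_|_|_ _]; rewrite ?zx // (inj_eq xI) xpair_eqE eq_sym;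
by rewrite (negbTE ii0).
Qed.

End Swaps.

(** * Circuits *)

Section Circuits.

Variable n : nat.
Implicit Types (x y a w : Z2 n) (A B D I J R U : {set 'I_n}) (j k d : 'I_n).
Implicit Types (g h : {perm Z2 n}) (S : seq (gate n)).

(** * Toffoli gates as permutations and their cost *)

Definition conj_on I x : bool := [forall i in I, x i].

Lemma conj_onU A B x : conj_on (A :|: B) x = conj_on A x && conj_on B x.
Proof.
apply/forall_inP/andP => [h|[/forall_inP hA /forall_inP hB] i].
  by split; apply/forall_inP => i hi; apply: h; rewrite inE hi ?orbT.
by rewrite inE => /orP[/hA|/hB].
Qed.

Lemma conj_on1 d x : conj_on [set d] x = x d.
Proof.
apply/forall_inP/idP => [|h i]; first by apply; rewrite inE.
by rewrite inE => /eqP->.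
Qed.

Lemma eq_conj_on I x y : {in I, x =1 y} -> conj_on I x = conj_on I y.
Proof.
move=> e; apply/forall_inP/forall_inP => h i hi; first by rewrite -e ?h.
by rewrite e ?h.
Qed.

Lemma conj_on_TOF I j x : j \notin I ->
  conj_on I (TOF I j x) = conj_on I x.
Proof.
move=> jI; apply: eq_conj_on => i iI; rewrite ffunE.
by case: eqP iI jI => // -> ->.
Qed.

Lemma TOFK I j : j \notin I -> involutive (TOF I j).
Proof.
move=> jI x; apply/ffunP => k; rewrite ffunE.
have := conj_on_TOF x jI; rewrite /conj_on => ->.
by rewrite !ffunE eqxx; case: eqP => // ->; rewrite addbK.
Qed.

Lemma TOF_inj I j : injective (TOF (I :\ j) j).
Proof. by apply: inv_inj; apply: TOFK; rewrite !inE eqxx. Qed.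

(* Removing [j] from [I] makes [TOF] a bijection for every [I] and [j]. *)
Definition tof I j : {perm Z2 n} := perm (@TOF_inj I j).

Lemma tofT I j : j \notin I -> tof I j =1 TOF I j.
Proof.
move=> jI x; rewrite permE (_ : I :\ j = I) //.
by apply/setP => k; rewrite !inE; case: eqP => // ->; rewrite (negbTE jI).
Qed.

Lemma tofE I j x k : j \notin I ->
  tof I j x k = if k == j then x j (+) conj_on I x else x k.
Proof. by move=> jI; rewrite tofT // ffunE. Qed.

Lemma conj_on_tof I J j x : j \notin J -> j \notin I ->
  conj_on I (tof J j x) = conj_on I x.
Proof.
move=> jJ jI; apply: eq_conj_on => i iI; rewrite tofE //.
by case: eqP iI jI => // -> ->.
Qed.

Lemma tofK I j : j \notin I -> (tof I j * tof I j)%g = 1%g.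
Proof. by move=> jI; apply/permP => x; rewrite permM perm1 !tofT // TOFK. Qed.

Lemma tof_commute I j J k : j \notin I -> k \notin J -> j \notin J ->
  k \notin I -> commute (tof I j) (tof J k).
Proof.
move=> jI kJ jJ kI; apply/permP => x; rewrite !permM; apply/ffunP => l.
rewrite !tofE ?conj_on_tof //.
case: (eqVneq k j) => [->|kj]; first by case: eqP; rewrite // addbAC.
by case: (eqVneq l k) => [->|//]; rewrite (negbTE kj).
Qed.

(** Writing [A] and [B] for the two conjunctions, wire [j] receives [(x d (+) A) && B] and, once [d]
    is restored, [x d && B]; the sum is [A && B]. *)
Lemma tof_commutator A B d j :
    d \notin A :|: B -> j \notin A :|: B -> d != j ->
  (tof A d * tof (d |: B) j * tof A d * tof (d |: B) j)%g = tof (A :|: B) j.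
Proof.
rewrite !inE !negb_or => /andP[dA dB] /andP[jA jB] dj.
have jdB : j \notin d |: B by rewrite !inE negb_or eq_sym dj.
apply/permP => x; rewrite !permM; apply/ffunP => l.
have jAB : j \notin A :|: B by rewrite !inE negb_or jA.
have jd1 : j \notin [set d] by rewrite inE eq_sym.
do 4 (rewrite ?tofE // ?conj_onU ?conj_on1 ?conj_on_tof //).
rewrite (negbTE dj) (eq_sym j d) (negbTE dj) !eqxx.
case: (eqVneq l j) => [_|lj].
  by case: (x j) (x d) (conj_on A x) (conj_on B x) => [] [] [] [].
by case: (eqVneq l d) => [->|//]; rewrite addbK.
Qed.

(** An upper bound on the length, so that costs add up; unlike in [implements], the outputs are not
    reordered. *)
Definition cost (l : nat) g : Prop :=
  exists S, [/\ is_circuit S, size S <= l & run S =1 g].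

Lemma cost_leq l l' g : l <= l' -> cost l g -> cost l' g.
Proof. by move=> ll [S [cS sS rS]]; exists S; split=> //; apply: leq_trans ll. Qed.

Lemma cost1 l : cost l 1%g.
Proof. by exists [::]; split=> // x; rewrite perm1. Qed.

Lemma costM l l' g h : cost l g -> cost l' h -> cost (l + l') (g * h)%g.
Proof.
move=> [S [cS sS rS]] [S' [cS' sS' rS']]; exists (S ++ S'); split.
- by rewrite /is_circuit all_cat; apply/andP.
- by rewrite size_cat leq_add.
- by move=> x; rewrite permM -rS -rS' /run foldl_cat.
Qed.

Lemma cost_tof I j : j \notin I -> #|I| <= 2 -> cost 1 (tof I j).
Proof.
move=> jI cI; exists [:: (I, j)]; split=> //=.
  by rewrite /is_circuit /= !inE jI cI.
by move=> x; rewrite tofT.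
Qed.

Lemma costV l g : cost l g -> cost l g^-1%g.
Proof.
move=> [S [cS sS rS]]; exists (rev S); split=> //.
- by rewrite /is_circuit all_rev.
- by rewrite size_rev.
move=> x; apply: (@perm_inj _ g); rewrite permKV -rS.
elim: S cS x {sS rS} => [//|[I j] S IH] /= /andP[gI cS] x.
move: gI; rewrite !inE /= => /andP[jI _].
by rewrite rev_cons -cats1 /run foldl_cat /= TOFK //; apply: IH.
Qed.

(* [D] is a set of dirty wires: they hold arbitrary values, to be restored.
   [N] is a by-product that changes these wires only; its cost bound
   allows it to be undone.  The recursive step conjugates by a gate with
   controls [c] in [I] and [d] in [D], after which the whole circuit for [d]
   becomes the new by-product. *)
Lemma cost_chain m I j D : #|I| <= m -> j \notin I -> [disjoint D & j |: I] ->
    #|I| <= #|D| + 2 ->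
  exists N, [/\ cost (2 * #|I| + 1) (tof I j * N)%g, cost (2 * #|I| + 1) N,
    (N * N)%g = 1%g
    & forall J k, k \notin J -> k \notin I -> [disjoint D & k |: J] ->
      commute N (tof J k)].
Proof.
elim: m I j D => [|m IH] I j D Im jI dD ID.
  exists 1%g; rewrite mulg1; split; rewrite ?mulg1 //; last 1 first.
  - by move=> J k _ _ _; apply/commute_sym/commute1.
  - by apply: cost_leq (cost_tof jI _); lia.
  - exact: cost1.
have [I2|I3] := leqP #|I| 2.
  exists 1%g; rewrite mulg1; split; rewrite ?mulg1 //; last 1 first.
  - by move=> J k _ _ _; apply/commute_sym/commute1.
  - by apply: cost_leq (cost_tof jI _); lia.
  - exact: cost1.
have /card_gt0P[c cI] : 0 < #|I| by lia.
have /card_gt0P[d dd] : 0 < #|D| by lia.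
have cIE : #|I| = #|I :\ c|.+1 by rewrite (cardsD1 c) cI.
have cDE : #|D| = #|D :\ d|.+1 by rewrite (cardsD1 d) dd.
have := disjointFr dD dd; rewrite !inE => /negbT; rewrite negb_or => /andP[dj dI].
have dI' : d \notin I :\ c by rewrite !inE negb_and dI orbT.
have dD' k J : [disjoint D & k |: J] -> [disjoint D :\ d & k |: J].
  by apply: disjointWl; apply: subD1set.
have jc : j != c by apply: contraNneq jI => ->.
have jcd : j \notin d |: [set c] by rewrite !inE negb_or eq_sym dj.
have jI' : j \notin I :\ c by rewrite !inE negb_and jI orbT.
have dDs (K : {set 'I_n}) : K \subset d |: (j |: I) -> [disjoint D :\ d & K].
  move=> /subsetP sK; apply/pred0P => k /=; apply/negP.
  move=> /andP[/[!inE] /andP[kd kD] /sK]; rewrite in_setU1 (negbTE kd) /=.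
  by rewrite (disjointFr dD kD).
have dD1 : [disjoint D :\ d & d |: (I :\ c)].
  by apply/dDs/setUS; rewrite subsetU // subD1set orbT.
have dD2 : [disjoint D :\ d & j |: (d |: [set c])].
  apply/dDs/subsetP => k; rewrite !inE => /or3P[]/eqP->.
  - by rewrite eqxx orbT.
  - by rewrite eqxx.
  - by rewrite cI !orbT.
have Im' : #|I :\ c| <= m by rewrite cIE ltnS in Im.
have ID' : #|I :\ c| <= #|D :\ d| + 2 by rewrite cIE cDE addSn ltnS in ID.
have [N1 [cV cN NN comN]] := IH _ _ _ Im' dI' dD1 ID'.
set T1 := tof (I :\ c) d in cV *; set G := tof (d |: [set c]) j.
have NG : commute N1 G by apply: comN.
have NT : commute N1 T1 by apply: comN.
have TT : (T1 * T1)%g = 1%g by apply: tofK.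
have GV : G^-1%g = G by apply/eqP; rewrite eq_invg_mul tofK.
have TV : T1^-1%g = T1 by apply/eqP; rewrite eq_invg_mul TT.
have IV : (tof I j)^-1%g = tof I j by apply/eqP; rewrite eq_invg_mul tofK.
have E : (G * T1 * G * T1)%g = tof I j.
  have := @tof_commutator (I :\ c) [set c] d j.
  rewrite setUC setD1K // => /(_ dI jI dj) /(congr1 (@invg _)).
  by rewrite !invMg GV TV IV !mulgA.
exists (T1 * N1)%g; split.
(* [E] ends in [T1], which cancels against the by-product; as [N1] commutes with [G], only two gates
   are added per control. *)
- have -> : (tof I j * (T1 * N1) = G * (T1 * N1) * G)%g.
    by rewrite -E -!mulgA (mulgA T1 T1) TT mul1g NG.
  have cG : cost 1 G.
    by apply: cost_tof => //; rewrite cardsU1 cards1; case: (_ \notin _).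
  by apply: (cost_leq _ (costM (costM cG cV) cG)); rewrite cIE mulnS !addnA addn1.
- by apply: cost_leq cV; rewrite cIE leq_add2r leq_mul2l leqnSn.
- by rewrite mulgA -(mulgA T1) NT mulgA TT mul1g NN.
- move=> J k kJ kI kD; apply: commute_sym; apply: commuteM; apply: commute_sym.
    apply: tof_commute => //.
    - by apply: contraTN dd => dJ; rewrite (disjointFl kD) // !inE dJ orbT.
    - by rewrite !inE negb_and kI orbT.
  by apply: comN; rewrite ?dD' // !inE negb_and kI orbT.
Qed.

(** At least [#|I| - 2] wires lie outside [j |: I], enough dirty wires for [cost_chain]; a second
    run of the by-product undoes it. *)
Lemma cost_tof_dirty I j : j \notin I -> 2 * #|I| <= n + 1 ->
  cost (4 * #|I| + 2) (tof I j).
Proof.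
move=> jI In; pose D : {set 'I_n} := ~: (j |: I).
have dD : [disjoint D & j |: I] by rewrite disjoint_sym disjoints_subset setCK.
have cD : #|j |: I| + #|D| = n by rewrite cardsC card_ord.
rewrite cardsU1 jI /= in cD.
have [|N [cT cN NN _]] := cost_chain (leqnn _) jI dD.
  card_lia.
have -> : tof I j = (tof I j * N * N)%g by rewrite -mulgA NN mulg1.
by apply: cost_leq (costM cT cN); card_lia.
Qed.

(* With a single dirty wire [d], split the controls into two halves: each half
   serves as the set of dirty wires for the other one. *)
Lemma cost_tof_big I j : j \notin I -> #|I| + 2 <= n ->
  cost (8 * #|I| + 20) (tof I j).
Proof.
move=> jI In.
have /card_gt0P[d] : 0 < #|~: (j |: I)|.
  have := cardsC (j |: I); rewrite card_ord cardsU1 jI /=; card_lia.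
rewrite !inE negb_or => /andP[dj dI].
have [A AI cA] : exists2 A : {set 'I_n}, A \subset I & #|A| = uphalf #|I|.
  have : 0 < 'C(#|I|, uphalf #|I|) by rewrite bin_gt0; card_lia.
  rewrite -cards_draws => /card_gt0P[A]; rewrite inE => /andP[AI /eqP cA].
  by exists A.
pose B := I :\: A.
have cB : #|A| + #|B| = #|I| by rewrite -(cardsID A I) (setIidPr AI).
have IE : I = A :|: B.
  by rewrite -{1}(setID I A) (setIidPr AI).
have BI : B \subset I by apply: subsetDl.
have dA : d \notin A by apply: contra dI; apply: (subsetP AI).
have dB : d \notin B by apply: contra dI; apply: (subsetP BI).
have jdB : j \notin d |: B.
  rewrite !inE negb_or eq_sym dj /=.
  by apply: contra jI => h; apply: (subsetP BI); rewrite !inE.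
have cdB : #|d |: B| = #|B|.+1 by rewrite cardsU1 dB.
rewrite {2}IE -(@tof_commutator A B d j) -?IE //.
have c1 : cost (4 * #|A| + 2) (tof A d) by apply: cost_tof_dirty => //; card_lia.
have c2 : cost (4 * #|d |: B| + 2) (tof (d |: B) j).
  by apply: cost_tof_dirty => //; card_lia.
by apply: cost_leq (costM (costM (costM c1 c2) c1) c2); card_lia.
Qed.

(** * Encoding points on chosen wires *)

Definition xorv x y : Z2 n := [ffun k => x k (+) y k].

Definition agree A a x : bool := [forall i in A, x i == a i].

Lemma cost_xor A a : (forall k, a k -> k \in A) ->
  exists2 g, cost #|A| g & forall x, g x = xorv x a.
Proof.
move=> aA; suff [g cg gE] : exists2 g, cost (size (enum A)) g &
    forall x, g x = [ffun k => x k (+) ((k \in enum A) && a k)].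
  exists g => [|x]; first by rewrite -cardE in cg.
  rewrite gE; apply/ffunP => k; rewrite !ffunE mem_enum.
  by case: (boolP (a k)) => [/aA ->|]; rewrite ?andbF.
have : uniq (enum A) by apply: enum_uniq.
elim: (enum A) => [_|j s IH /= /andP[js /IH[g cg gE]]].
  exists 1%g; first exact: cost1.
  by move=> x; rewrite perm1; apply/ffunP => k; rewrite ffunE addbF.
have j0 : j \notin (set0 : {set 'I_n}) by rewrite inE.
exists ((if a j then tof set0 j else 1) * g)%g.
  rewrite -add1n; apply: costM => //; case: ifP => _; last exact: cost1.
  by apply: cost_tof; rewrite ?cards0.
move=> x; rewrite permM gE; apply/ffunP => k; rewrite !ffunE inE.
have c0 : conj_on set0 x by apply/forall_inP => i; rewrite inE.
case: ifP => aj; rewrite ?tofE ?perm1 // ?c0; case: eqVneq => //= ->.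
  by rewrite (negbTE js) aj addbF.
by rewrite aj andbF.
Qed.

(** Conjugating by NOT gates on the wires of [A] where [a] is zero turns the test for the pattern
    [a] into a plain conjunction. *)
Lemma cost_cflip A a j c : j \notin A -> cost c (tof A j) ->
  exists2 g, cost (2 * #|A| + c) g &
    forall x, g x = [ffun k => x k (+) ((k == j) && agree A a x)].
Proof.
move=> jA ct; pose b : Z2 n := [ffun k => (k \in A) && ~~ a k].
have [|h ch hE] := @cost_xor A b; first by move=> k; rewrite ffunE => /andP[].
exists (h * tof A j * h)%g; first by apply: cost_leq (costM (costM ch ct) ch); card_lia.
move=> x; rewrite !permM !hE; apply/ffunP => k; rewrite !ffunE tofE // !ffunE.
have -> : conj_on A (xorv x b) = agree A a x.
  apply: eq_forallb_in => i iA; rewrite !ffunE iA /=.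
  by case: (x i) (a i) => [] [].
case: eqVneq => [->|_]; last by rewrite addbK addbF.
by rewrite (negbTE jA) !addbF.
Qed.

Lemma cost_cadd A B a w : 2 * #|A| <= n + 1 -> [disjoint A & B] ->
    (forall k, w k -> k \in B) ->
  exists2 g, cost (#|B| * (6 * #|A| + 2)) g &
    forall x, g x = [ffun k => x k (+) (w k && agree A a x)].
Proof.
move=> An dAB wB; suff [g cg gE] : exists2 g, cost (size (enum B) * (6 * #|A| + 2)) g &
    forall x, g x = [ffun k => x k (+) [&& k \in enum B, w k & agree A a x]].
  exists g => [|x]; first by rewrite -cardE in cg.
  rewrite gE; apply/ffunP => k; rewrite !ffunE mem_enum.
  by case: (boolP (w k)) => [/wB ->|]; rewrite ?andbF.
have : uniq (enum B) by apply: enum_uniq.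
have : {subset enum B <= B} by move=> k; rewrite mem_enum.
elim: (enum B) => [_ _|j s IH sB /= /andP[js us]].
  exists 1%g; first exact: cost1.
  by move=> x; rewrite perm1; apply/ffunP => k; rewrite ffunE addbF.
have {IH}[||g cg gE] := IH; [by move=> k ks; apply: sB; rewrite inE ks orbT|by []|].
have jA : j \notin A by rewrite (disjointFl dAB) // sB ?mem_head.
have [h ch hE] := cost_cflip a jA (cost_tof_dirty jA An).
exists ((if w j then h else 1) * g)%g.
  apply: cost_leq (costM (_ : cost (6 * #|A| + 2) _) cg); first by rewrite mulSn.
  case: ifP => _; last exact: cost1.
  by apply: cost_leq ch; card_lia.
move=> x; rewrite permM gE; apply/ffunP => k; rewrite !ffunE inE.
case: ifP => wj; rewrite ?perm1 ?hE ?ffunE; last first.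
  by case: eqVneq => //= ->; rewrite wj andbF.
have -> : agree A a [ffun k => x k (+) ((k == j) && agree A a x)] = agree A a x.
  apply: eq_forallb_in => i iA; rewrite !ffunE.
  by case: (eqVneq i j) jA => [<-|_ _]; rewrite ?iA /= ?addbF.
case: eqVneq => [->|_]; last by rewrite addbF.
by rewrite (negbTE js) wj /= addbF.
Qed.

(** The points are treated one by one: their patterns on [A] are distinct, and writing on [B] leaves
    these patterns unchanged. *)
Lemma cost_encode (T : finType) (x w : T -> Z2 n) A B : 2 * #|A| <= n + 1 ->
    [disjoint A & B] -> (forall i i', agree A (x i) (x i') -> i = i') ->
    (forall i k, w i k -> k \in B) ->
  exists2 g, cost (#|T| * #|B| * (6 * #|A| + 2)) g &
    forall i, g (x i) = xorv (x i) (w i).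
Proof.
move=> An dAB xA wB.
have agw i y (z : Z2 n) : (forall k, z k -> k \in B) ->
    agree A (x i) (xorv y z) = agree A (x i) y.
  move=> zB; apply: eq_forallb_in => k kA; rewrite !ffunE.
  by case: (boolP (z k)) => [/zB|_]; rewrite ?(disjointFr dAB kA) ?addbF.
suff [g cg gE] : exists2 g, cost (size (enum T) * (#|B| * (6 * #|A| + 2))) g &
    forall i y, agree A (x i) y ->
      g y = xorv y [ffun k => (i \in enum T) && w i k].
  exists g => [|i]; first by rewrite -mulnA -cardE in cg *.
  rewrite (gE i); last by apply/forall_inP.
  by apply/ffunP => k; rewrite !ffunE mem_enum.
have : uniq (enum T) by apply: enum_uniq.
elim: (enum T) => [_|j s IH /= /andP[js /IH[g cg gE]]].
  exists 1%g; first exact: cost1.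
  by move=> i y _; rewrite perm1; apply/ffunP => k; rewrite !ffunE addbF.
have [h ch hE] := cost_cadd (x j) An dAB (wB j).
exists (h * g)%g; first by rewrite mulSn; apply: costM.
move=> i y iy; rewrite permM.
have hyE : h y = xorv y [ffun k => (i == j) && w i k].
  rewrite hE; apply/ffunP => k; rewrite !ffunE; congr (_ (+) _).
  case: eqVneq => [<-|ij]; first by rewrite iy andbT.
  apply/andP => -[_ jy]; move/eqP: ij; apply; apply: xA.
  apply/forall_inP => l lA.
  by rewrite -(eqP (forall_inP iy l lA)) (eqP (forall_inP jy l lA)).
rewrite (gE i).
  rewrite hyE; apply/ffunP => k; rewrite !ffunE inE.
  by case: eqVneq => //= [->|_]; rewrite ?(negbTE js) addbF.
by rewrite hyE agw // => k; rewrite ffunE => /andP[_ /wB].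
Qed.

(* View [x] as a matrix with one column per wire: at most [2 ^ #|T|] columns
   are distinct, and a CNOT from a wire with an equal column clears any other. *)
Lemma cost_dedup (T : finType) (x : T -> Z2 n) :
  exists R, #|R| <= 2 ^ #|T| /\
    exists2 g, cost n g & forall i k, g (x i) k -> k \in R.
Proof.
pose col k : {ffun T -> bool} := [ffun i => x i k].
(* [rep k] depends only on the column of [k]; the default is never taken, [k] itself being a
   candidate. *)
pose rep k := odflt k [pick k' | col k' == col k].
have repP k : col (rep k) = col k.
  by rewrite /rep; case: pickP => [k' /eqP|/(_ k)]; rewrite ?eqxx.
have eq_rep k k' : col k = col k' -> rep k = rep k'.
  move=> e; rewrite /rep; under eq_pick => l do rewrite e.
  by case: pickP => // /(_ k'); rewrite eqxx.
pose R : {set 'I_n} := [set k | rep k == k].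
have repR k : rep k \in R by rewrite inE (eq_rep _ k) ?repP.
exists R; split.
  have cI : {in R &, injective col}.
    by move=> k k'; rewrite !inE => /eqP <- /eqP <-; rewrite !repP => /eq_rep.
  rewrite -(card_in_imset cI) (leq_trans (max_card _)) //.
  by rewrite card_ffun card_bool.
suff [g cg gE] : exists2 g, cost (size (enum (~: R))) g &
    forall y k, g y k = y k (+) ((k \in enum (~: R)) && y (rep k)).
  exists g.
    by apply: cost_leq cg; rewrite -cardE -[n in _ <= n]card_ord max_card.
  move=> i k; rewrite gE mem_enum inE.
  case: (boolP (k \in R)) => //= _.
  by have /ffunP/(_ i) := repP k; rewrite !ffunE => ->; rewrite addbb.
have : {subset enum (~: R) <= ~: R} by move=> k; rewrite mem_enum.
elim: (enum (~: R)) => [_|j s IH sR].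
  by exists 1%g; [exact: cost1|move=> y k; rewrite perm1 addbF].
have [|g cg gE] := IH; first by move=> k ks; apply: sR; rewrite inE ks orbT.
have jR : j \notin R by have := sR j (mem_head _ _); rewrite inE.
have jr : j \notin [set rep j].
  by rewrite inE; apply: contraNneq jR => ->; apply: repR.
case: (boolP (j \in s)) => js.
  exists g; first exact: cost_leq cg.
  by move=> y k; rewrite gE inE; case: eqVneq => // ->; rewrite js.
exists (tof [set rep j] j * g)%g.
  by rewrite /= -add1n; apply: costM => //; apply: cost_tof; rewrite ?cards1.
move=> y k; rewrite permM gE inE !tofE // conj_on1.
have -> : (rep k == j) = false.
  by apply: contraNF jR => /eqP <-; apply: repR.
by case: (eqVneq k j) => [->|//]; rewrite (negbTE js) /= addbF.
Qed.

(* The points are first encoded on the wires [U]; this encoding then serves to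
   clear the wires [R]. *)
Lemma cost_canon (T : finType) (x : T -> Z2 n) :
    injective x -> 2 * 2 ^ #|T| <= n + 1 ->
  exists2 R : {set 'I_n}, #|R| <= 2 ^ #|T| &
    forall (U : {set 'I_n}) (p : T -> Z2 n), injective p ->
    [disjoint R & U] -> 2 * #|U| <= n + 1 -> (forall i k, p i k -> k \in U) ->
    exists2 g, cost (n + #|T| * #|U| * (6 * #|R| + 2) +
                     #|T| * #|R| * (6 * #|U| + 2)) g &
      forall i, g (x i) = p i.
Proof.
move=> xI Tn; have [R [cR [g1 c1 g1R]]] := cost_dedup x.
exists R => // U p pI dRU Un pU.
have agree_inj (q : T -> Z2 n) (A : {set 'I_n}) : injective q ->
    (forall i k, q i k -> k \in A) ->
    forall i i', agree A (q i) (q i') -> i = i'.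
  move=> qI qA i i' /forall_inP h; apply: qI; apply/ffunP => k.
  have [kA|kA] := boolP (k \in A); first by apply/eqP; rewrite eq_sym; apply: h.
  by rewrite !(contraNF (@qA _ _) kA).
(* After [g1] the points vanish off [R], so their patterns on [R] are distinct and [g2] can add
   [p i] on [U]. Then [U] carries [p i] alone, which identifies the point, and [g3] clears [R] by
   adding [g1 (x i)] again. *)
have [||||g2 c2 g2E] := @cost_encode T (fun i => g1 (x i)) p R U => //.
- by rewrite (leq_trans _ Tn) // leq_mul2l cR.
- by apply: agree_inj => // i i' /perm_inj/xI.
have [|||g3 c3 g3E] := @cost_encode T
    (fun i => xorv (g1 (x i)) (p i)) (fun i => g1 (x i)) U R _ _ _ g1R => //.
- by rewrite disjoint_sym.
- move=> i i' /forall_inP h; apply: (agree_inj p U pI pU).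
  apply/forall_inP => k kU; move: (h k kU); rewrite !ffunE.
  by rewrite !(contraNF (@g1R _ k)) ?(disjointFl dRU kU) // !addFb.
exists (g1 * g2 * g3)%g; first exact: costM (costM c1 c2) c3.
move=> i; rewrite !permM g2E g3E; apply/ffunP => k; rewrite !ffunE.
by rewrite addbAC addbb.
Qed.

(* [k] points are moved into a subcube and back, around a multiply controlled
   NOT on all the wires outside this subcube. *)
Definition swap_cost m :=
  let k := 2 ^ m.+1 in
  10 * n + 20 + 2 * (n + k * m.+1 * (6 * 2 ^ k + 2) + k * 2 ^ k * (6 * m.+1 + 2)).

Lemma cost_swaps m (x : Z2 m * bool -> Z2 n) :
    injective x -> 0 < m -> 2 * 2 ^ (2 ^ m.+1) + 2 * m.+1 <= n ->
  exists2 s : {perm Z2 n}, cost (swap_cost m) s & is_swap x s.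
Proof.
move=> xI m0 mn.
have cT : #|{: Z2 m * bool}| = 2 ^ m.+1.
  by rewrite card_prod card_ffun card_bool card_ord expnS mulnC.
have [|R cR canon] := cost_canon xI; first by rewrite cT; card_lia.
rewrite cT in cR canon.
have cRC : #|R| + #|~: R| = n by rewrite cardsC card_ord.
have : m.+1 <= size (enum (~: R)) by rewrite -cardE; card_lia.
have : uniq (enum (~: R)) by apply: enum_uniq.
have : {subset enum (~: R) <= ~: R} by move=> k; rewrite mem_enum.
case: (enum (~: R)) => //= t es sR /andP[tes ues] mes.
pose e (i : 'I_m) := nth t es i.
have ees i : e i \in es by rewrite mem_nth // (leq_trans (ltn_ord i)).
have et i : e i != t by apply: contraNneq tes => <-.
have eI : injective e.
  move=> i i' /eqP; rewrite nth_uniq ?(leq_trans (ltn_ord _)) //.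
  by move=> /eqP/val_inj.
pose U := t |: [set e i | i : 'I_m].
have tE : t \notin [set e i | i : 'I_m].
  by apply/imsetP => -[i _ ti]; move: (et i); rewrite -ti eqxx.
have cU : #|U| = m.+1 by rewrite cardsU1 tE card_imset // card_ord.
(* The two points of a pair differ in wire [t] only, so the swap becomes a flip of [t] on the
   subcube. *)
pose p (i : Z2 m * bool) : Z2 n :=
  [ffun k => if k == t then i.2 else [exists l, (e l == k) && i.1 l]].
have pt i : p i t = i.2 by rewrite ffunE eqxx.
have pe i l : p i (e l) = i.1 l.
  rewrite ffunE (negbTE (et l)); apply/existsP/idP => [[l' /andP[/eqP/eI -> //]]|il].
  by exists l; rewrite eqxx.
have pI : injective p.
  move=> [i b] [i' b'] E; congr (_, _).
    by apply/ffunP => l; have := pe (i, b) l; rewrite E pe.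
  by have := pt (i, b); rewrite E pt.
have pU i k : p i k -> k \in U.
  rewrite ffunE !inE; case: eqP => //= _ /existsP[l /andP[/eqP <- _]].
  exact: imset_f.
have Up y : (forall k, y k -> k \in U) -> y = p ([ffun l => y (e l)], y t).
  move=> yU; apply/ffunP => k; case: (boolP (k \in U)) => kU; last first.
    by rewrite (contraNF (@yU k) kU) (contraNF (@pU _ k) kU).
  move: kU; rewrite !inE => /orP[/eqP->|/imsetP[l _ ->]]; first by rewrite pt.
  by rewrite pe ffunE.
have dRU : [disjoint R & U].
  rewrite disjoint_sym disjoints_subset; apply/subsetP => k.
  rewrite 2!inE => /orP[/eqP->|/imsetP[l _ ->]]; apply: sR.
    exact: mem_head.
  by rewrite inE ees orbT.
have [|g cg gE] := canon U p pI dRU _ pU; first by rewrite cU; card_lia.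
have cUC : #|U| + #|~: U| = n by rewrite cardsC card_ord.
have tU : t \notin ~: U by rewrite !inE eqxx.
(* [0 < m] puts a wire other than [t] in [U]: the dirty wire required by [cost_tof_big]. *)
have [|s0 cs0 s0E] := cost_cflip [ffun=> false] tU (cost_tof_big tU _).
  by rewrite cU in cUC; card_lia.
exists (g * s0 * g^-1)%g; last split.
- apply: cost_leq (costM (costM cg cs0) (costV cg)).
  rewrite /swap_cost cU; cbv zeta; move: cUC cR; rewrite cU.
  move: #|~: U| #|R| (2 ^ m.+1) => u r k cu cr.
  have h1 : k * m.+1 * (6 * r + 2) <= k * m.+1 * (6 * 2 ^ k + 2).
    by rewrite leq_mul2l leq_add2r leq_mul2l cr !orbT.
  have h2 : k * r * (6 * m.+1 + 2) <= k * 2 ^ k * (6 * m.+1 + 2).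
    by rewrite leq_mul2r leq_mul2l cr !orbT.
  lia.
- move=> i b; rewrite !permM gE; apply: (@perm_inj _ g); rewrite permKV gE s0E.
  have -> : agree (~: U) [ffun=> false] (p (i, b)).
    apply/forall_inP => k; rewrite inE => kU.
    by rewrite (contraNF (@pU _ k) kU) ffunE.
  apply/ffunP => k; rewrite !ffunE andbT; case: eqP => _; last by rewrite addbF.
  by rewrite addbT.
- move=> y yx; rewrite !permM; apply: (@perm_inj _ g); rewrite permKV s0E.
  (* If [g y] vanished off [U], it would be some [p i], hence [y] would be some [x i]. *)
  case: (boolP (agree _ _ _)) => [/forall_inP ag|_].
    have /Up gy : forall k, g y k -> k \in U.
      move=> k; apply: contraTT => kU; have := ag k; rewrite inE kU ffunE.
      by move=> /(_ isT)/eqP->.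
    by have /eqP[] := yx ([ffun l => g y (e l)], g y t); apply: (@perm_inj _ g); rewrite gE.
  by apply/ffunP => k; rewrite ffunE andbF addbF.
Qed.

End Circuits.

(** * Cost of even permutations *)

Section EvenPermutations.

Variables (n m c : nat).
Implicit Types (g h s : {perm Z2 n}).

Hypothesis swapP : forall x : Z2 m * bool -> Z2 n, injective x ->
  exists2 s, cost c s & is_swap x s.

Lemma card_Z2 k : #|{: Z2 k}| = 2 ^ k.
Proof. by rewrite card_ffun card_bool card_ord. Qed.

(** As long as at least [3 * 2 ^ m] points are moved, [moved_swap] yields a swap that removes at
    least [2 ^ m] of them. *)
Lemma cost_reduce r g : #|moved g| < (r + 3) * 2 ^ m ->
  exists2 h, cost (r * c) h & #|moved (g * h)%g| < 3 * 2 ^ m.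
Proof.
elim: r g => [|r IH] g gr; first by exists 1%g; [exact: cost1|rewrite mulg1].
have [g3|g3] := ltnP #|moved g| (3 * 2 ^ m).
  by exists 1%g; [exact: cost1|rewrite mulg1].
have [||x xI xs] := @moved_swap (Z2 m) _ g; rewrite ?card_Z2 ?expn_gt0 //.
have [s cs /xs] := swapP xI; rewrite card_Z2 => sg.
have [|h ch hg] := IH (g * s)%g.
  by move: gr; rewrite addSn mulSn; card_lia.
exists (s * h)%g; first by rewrite mulSn; apply: costM.
by rewrite mulgA.
Qed.

(** Two swaps sharing all pairs but one have a product of two transpositions; the shared pairs are
    taken in the complement [F] of the four points, where the bound on [2 ^ n] leaves room. *)
Lemma cost_tperm2 (a a' b b' : Z2 n) : 2 * 2 ^ m + 4 <= 2 ^ n ->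
  a != a' -> b != b' -> cost (c + c) (tperm a a' * tperm b b')%g.
Proof.
move=> mn aa bb; pose F := ~: [set a; a'; b; b'].
have cF : #|{: Z2 m * bool}| <= size (enum F).
  rewrite -cardE card_prod card_bool card_Z2 mulnC.
  have := cardsC [set a; a'; b; b']; rewrite -/F card_Z2.
  have : #|[set a; a'; b; b']| <= 4.
    by rewrite -!setUA !cardsU1 cards1; do !case: (_ \notin _).
  move: mn; move: #|F| #|[set a; a'; b; b']| => u v; lia.
pose y i := nth a (enum F) (@enum_rank (Z2 m * bool)%type i).
have yF i : y i \in F.
  by rewrite -mem_enum mem_nth // (leq_trans (ltn_ord _)).
have yI : injective y.
  move=> i i' /eqP; rewrite nth_uniq ?enum_uniq ?(leq_trans (ltn_ord _)) //.
  by move=> /eqP/val_inj/enum_rank_inj.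
pose i0 : Z2 m := [ffun=> false].
pose x (e e' : Z2 n) (i : Z2 m * bool) :=
  if i.1 == i0 then if i.2 then e' else e else y i.
have xI e e' : e != e' -> e \notin F -> e' \notin F -> injective (x e e').
  move=> ee eF eF' [i d] [i' d']; rewrite /x /=.
  have ye i1 : y i1 != e by apply: contraNneq eF => <-.
  have ye' i1 : y i1 != e' by apply: contraNneq eF' => <-.
  case: eqVneq => [->|_]; case: eqVneq => [->|_] //.
  - by case: d d' => [] [] // h; move: ee; rewrite h eqxx.
  - by case: d => h; [move: (ye' (i', d'))|move: (ye (i', d'))]; rewrite h eqxx.
  - by case: d' => h; [move: (ye' (i, d))|move: (ye (i, d))]; rewrite h eqxx.
  - exact: yI.
have xaI : injective (x a a') by apply: xI; rewrite // !inE negbK eqxx ?orbT.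
have xbI : injective (x b b') by apply: xI; rewrite // !inE negbK eqxx ?orbT.
have [s cs sa] := swapP xaI; have [s' cs' sb] := swapP xbI.
have := is_swap_tperm xaI xbI _ sa sb; rewrite /x => /(_ i0) /=.
rewrite eqxx => <-; first exact: costM.
by move=> i d /negbTE ->.
Qed.

Lemma moved_tperm g y : y \in moved g ->
  #|moved (g * tperm y (g y))%g| < #|moved g|.
Proof.
move=> yg; apply: proper_card; apply/properP; split; last first.
  by exists y => //; rewrite inE permM tpermR eqxx.
apply/subsetP => z; rewrite !inE permM; apply: contra => /eqP gz.
rewrite gz; case: tpermP => // [e|e].
  by move: yg; rewrite inE -e gz eqxx.
by move: gz; rewrite [RHS]e => /perm_inj ->.
Qed.

(** Transpositions are peeled off two at a time: after the first one the permutation is odd, hence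
    not the identity, so a second exists. *)
Lemma cost_small r g : 2 * 2 ^ m + 4 <= 2 ^ n ->
  ~~ odd_perm g -> #|moved g| <= r -> cost (r * (c + c)) g.
Proof.
move=> mn; elim/ltn_ind: r g => r IH g eg gr.
have [g0|] := posnP #|moved g|.
  suff -> : g = 1%g by apply: cost1.
  apply/permP => y; rewrite perm1; apply/eqP; apply/negPn/negP => yg.
  by move/eqP: g0; rewrite cards_eq0 => /eqP/setP/(_ y); rewrite !inE yg.
move=> /card_gt0P[y yg]; have yg1 := moved_tperm yg.
have yy : y != g y by move: yg; rewrite inE eq_sym.
move: yg1; set g1 := (g * _)%g => yg1.
have og1 : odd_perm g1 by rewrite odd_permM odd_tperm yy (negbTE eg).
have [g0|] := posnP #|moved g1|.
  suff g11 : g1 = 1%g by rewrite g11 odd_perm1 in og1.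
  apply/permP => z; rewrite perm1; apply/eqP; apply/negPn/negP => zg.
  by move/eqP: g0; rewrite cards_eq0 => /eqP/setP/(_ z); rewrite !inE zg.
move=> /card_gt0P[z zg]; have zg1 := moved_tperm zg.
have zz : z != g1 z by move: zg; rewrite inE eq_sym.
move: zg1; set g2 := (g1 * _)%g => zg1.
have eg2 : ~~ odd_perm g2 by rewrite odd_permM odd_tperm zz og1.
have -> : g = (g2 * (tperm z (g1 z) * tperm y (g y)))%g.
  by rewrite /g2 /g1 -!mulgA (mulgA (tperm z _)) tperm2 mul1g tperm2 mulg1.
case: r gr IH => [|r] gr IH; first by move: (leq_trans yg1 gr); rewrite ltn0.
rewrite mulSn addnC; apply: costM (cost_tperm2 mn zz yy).
by apply: IH => //; rewrite -ltnS (leq_trans _ gr) // (leq_trans zg1) // ltnW.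
Qed.

End EvenPermutations.

(** For [3 < n] a gate misses some wire [d]; [tof_commutator] writes it with two factors, each
    occurring twice, so it is even. *)
Lemma cost_even n l (g : {perm Z2 n}) : 3 < n -> cost l g -> ~~ odd_perm g.
Proof.
move=> n3 [S [cS _ rS]]; elim: S cS g rS => [_ g rS|[I j] S IH /= /andP[]].
  suff -> : g = 1%g by rewrite odd_perm1.
  by apply/permP => x; rewrite perm1 -rS.
rewrite !inE /= => /andP[jI I2] cS g rS.
have /card_gt0P[d] : 0 < #|~: (j |: I)|.
  have := cardsC (j |: I); rewrite card_ord cardsU1 jI /=.
  move: I2 n3; move: #|I| #|~: _| => u v; lia.
rewrite !inE negb_or => /andP[dj dI].
have -> : g = (tof I j * ((tof I j)^-1 * g))%g by rewrite mulgA mulgV mul1g.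
rewrite odd_permM negb_add; apply/eqP; transitivity false.
  have := @tof_commutator n I set0 d j; rewrite setU0 => /(_ dI jI dj) <-.
  by rewrite !odd_permM; do 2!case: (odd_perm _).
apply/esym/negbTE/IH => // x; rewrite permM -rS /=.
by congr (run S _); rewrite -tofT // permKV.
Qed.

(** * Numeric bound on the cost of a swap *)

Lemma sqr_le_exp2 k : k ^ 2 <= 2 * 2 ^ k.
Proof.
suff /andP[] : (2 * k + 1 <= 4 * 2 ^ k) && (k ^ 2 <= 2 * 2 ^ k) by [].
(* The factor 2 serves [k = 3] alone; from 4 on, [k ^ 2 <= 2 ^ k] is proved along with
   [2 * k + 1 <= 2 ^ k]. *)
suff : [/\ k + 1 <= 2 ^ k & (k < 4) || (k ^ 2 <= 2 ^ k) && (2 * k + 1 <= 2 ^ k)].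
  move=> [h1]; case: ltnP => /= [|_ /andP[h2 h3]]; last by lia.
  by move: h1; do 4?[case: k => [//|k]].
elim: k => [//|k [IH1 IH2]]; rewrite expnS; split; first lia.
have [k4|k4] := ltnP k.+1 4; first by [].
move: IH2; rewrite /= ltnNge.
have [k3|k3] := leqP 4 k => /=; first by move=> /andP[]; rewrite !expnS; nia.
by have -> : k = 3 by lia.
Qed.

(** With [k = 2 ^ m.+1] and [q = 2 ^ k], the hypothesis reads [q ^ 2 <= n], while [k ^ 2 <= 2 * q];
    both encoding terms are thus [O(q ^ 2)]. *)
Lemma swap_cost_bound n m : 4 ^ (2 ^ m.+1) <= n -> swap_cost n m <= 96 * n.
Proof.
rewrite /swap_cost; cbv zeta.
have : m.+1 <= 2 ^ m.+1 by apply/ltnW/ltn_expl.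
have : 2 <= 2 ^ m.+1 by rewrite expnS leq_pmulr // expn_gt0.
move: (m.+1) (2 ^ m.+1) => l k k2 lk kn.
have := sqr_le_exp2 k; have : 4 <= 2 ^ k by rewrite -[4]/(2 ^ 2) leq_exp2l.
have q4 : 4 ^ k = 2 ^ k * 2 ^ k by rewrite -expnMn.
move: kn; rewrite q4 expnS expn1; move: (2 ^ k) => q qn q4' kq.
have h1 : k * l * (6 * q + 2) <= k * k * (7 * q).
  by apply: leq_mul; [rewrite leq_mul2l lk orbT|lia].
have h2 : k * q * (6 * l + 2) <= k * q * (8 * k) .
  by rewrite leq_mul2l; apply/orP; right; lia.
have h3 : k * k * q <= 2 * q * q by rewrite leq_mul2r kq orbT.
nia.
Qed.

(** * Upper bound *)

Section Upper.

Variables (n m : nat).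
Hypotheses (m0 : 0 < m) (mn : 4 ^ (2 ^ m.+1) <= n).

Let mle : 2 * 2 ^ (2 ^ m.+1) + 2 * m.+1 <= n.
Proof.
apply: leq_trans mn.
have : m.+1 <= 2 ^ m.+1 by apply/ltnW/ltn_expl.
have : 4 <= 2 ^ m.+1 by rewrite -[4]/(2 ^ 2) leq_exp2l.
move: (m.+1) (2 ^ m.+1) => l k k4 lk.
have : k < 2 ^ k by apply: ltn_expl.
have : 2 ^ 4 <= 2 ^ k by rewrite leq_exp2l.
rewrite -[4 ^ k]/((2 * 2) ^ k) expnMn; move: (2 ^ k) => q; nia.
Qed.

Let nm : 2 * m + 3 <= n.
Proof.
apply: leq_trans mle; have := ltn_expl (2 ^ m.+1) (ltnSn 1).
have : m.+1 < 2 ^ m.+1 by apply: ltn_expl.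
lia.
Qed.

(** One of the 7 shares pays for the [2 ^ (n - m)] swaps of [cost_reduce]; the other six cover the
    fewer than [3 * 2 ^ m] points still moved, at two swaps each, since [2 ^ m <= 2 ^ (n - m)]. *)
Lemma cost_even_perm (g : {perm Z2 n}) : ~~ odd_perm g ->
  cost (7 * 96 * n * 2 ^ (n - m)) g.
Proof.
move=> eg; have swapP (x : Z2 m * bool -> Z2 n) : injective x ->
    exists2 s, cost (96 * n) s & is_swap x s.
  move=> xI; have [s cs sx] := cost_swaps xI m0 mle.
  by exists s => //; apply: cost_leq cs; apply: swap_cost_bound.
have [|h ch hg] := cost_reduce (r := 2 ^ (n - m)) swapP (g := g).
  rewrite mulnDl -expnD subnK; last by lia.
  rewrite (leq_ltn_trans (max_card _)) // card_Z2.
  by rewrite -[X in X < _]addn0 ltn_add2l muln_gt0 expn_gt0.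
have n3 : 3 < n by lia.
have eh := cost_even n3 ch.
have p4 : 2 ^ (2 * m) * 4 <= 2 ^ n.
  by rewrite -[4]/(2 ^ 2) -expnD leq_exp2l //; lia.
have pm : 2 <= 2 ^ m by rewrite -[2]/(2 ^ 1) leq_exp2l.
have p2 : 2 ^ (2 * m) = 2 ^ m * 2 ^ m by rewrite mul2n -addnn expnD.
have p1 : 2 ^ m <= 2 ^ (n - m) by rewrite leq_exp2l //; lia.
have cgh : cost (3 * 2 ^ m * (96 * n + 96 * n)) (g * h)%g.
  apply: (cost_small swapP); last exact: ltnW.
    by move: p4 pm; rewrite p2; move: (2 ^ m) (2 ^ n) => u v; nia.
  by rewrite odd_permM (negbTE eg) (negbTE eh).
have -> : g = (g * h * h^-1)%g by rewrite mulgK.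
apply: cost_leq (costM cgh (costV ch)).
by move: p1; move: (2 ^ m) (2 ^ (n - m)) => u v; nia.
Qed.

(** The permutation run by any circuit is even, so it also has a short circuit; the reordering of
    the outputs is kept. *)
Lemma L0_upper : L0 n <= 7 * 96 * n * 2 ^ (n - m).
Proof.
apply/bigmax_leqP => f fF; have [_ minf] := Lf0_min fF.
move: fF; rewrite inE => /asboolP[S /andP[cS iS]].
have runI : injective (@run n S).
  elim: S cS {iS} => [_ x y //|[I j] S IH /= /andP[]].
  rewrite !inE /= => /andP[jI _] cS x y /= /(IH cS).
  by apply: (inv_inj (TOFK jI)).
have cg : cost (size S) (perm runI) by exists S; split=> // x; rewrite permE.
have n3 : 3 < n by lia.
have [S' [cS' sS' rS']] := cost_even_perm (cost_even n3 cg).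
apply: leq_trans sS'; apply: minf => //.
apply/existsP; have /existsP[p /forallP ip] := iS; exists p.
apply/forallP => x; rewrite (eqP (ip x)); apply/eqP/ffunP => i.
by rewrite !ffunE rS' permE.
Qed.

End Upper.

(** * Lower bound by counting circuits *)

Section Lower.

Variable n : nat.

(* Every gate with at most two controls is [gate_of (j, a, b)]: take [a = b] for
   one control and [a = b = j] for none. *)
Definition gate_of (t : 'I_n * 'I_n * 'I_n) : gate n :=
  ([set t.1.2; t.2] :\ t.1.1, t.1.1).

Lemma gate_ofP (S : seq (gate n)) : is_circuit S ->
  exists ts, S = map gate_of ts.
Proof.
elim: S => [_|[I j] S IH /= /andP[]]; first by exists [::].
rewrite !inE /= => /andP[jI I2] /IH[ts ->].
suff [a [b e]] : exists a b, I = [set a; b] :\ j.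
  by exists ((j, a, b) :: ts); rewrite e.
have Ij : I :\ j = I.
  by apply/setP => k; rewrite !inE; case: eqP => // ->; rewrite (negbTE jI).
have [I0|] := posnP #|I|.
  exists j, j; rewrite setUid setDv; apply/eqP; rewrite -cards_eq0; exact/eqP.
rewrite leq_eqVlt; case: eqP => [/esym/eqP/cards1P[a aE] _|_ I1].
  by exists a, a; rewrite setUid -aE Ij.
have /cards2P[a [b [_ abE]]] : #|I| == 2 by rewrite eqn_leq I2.
by exists a, b; rewrite -abE Ij.
Qed.

(** [None] pads shorter circuits, so that codes of one length cover all lengths up to [L]. *)
Definition decode L
    (c : 'S_n * L.-tuple (option ('I_n * 'I_n * 'I_n))) : {ffun Z2 n -> Z2 n} :=
  [ffun x => [ffun i => run (map gate_of (pmap id c.2)) x (c.1 i)]].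

Lemma decodeP L (S : seq (gate n)) f : is_circuit S -> implements S f ->
  size S <= L -> exists c : 'S_n * L.-tuple _, f = decode c.
Proof.
move=> /gate_ofP[ts ->] /existsP[p /forallP pf]; rewrite size_map => sL.
have szu : size (map Some ts ++ nseq (L - size ts) None) == L.
  by rewrite size_cat size_map size_nseq subnKC.
exists (p, Tuple szu); apply/ffunP => x; rewrite (eqP (pf x)) ffunE /=.
rewrite pmap_cat (_ : pmap id (nseq _ None) = [::]); last by elim: (L - _).
by rewrite cats0 map_pK.
Qed.

Lemma expn_leq_fact M j : M ^ j <= (M + j)`!.
Proof.
elim: j => [|j IH]; first by rewrite fact_gt0.
by rewrite expnS addnS factS leq_mul // -addnS leq_addr.
Qed.

Lemma fact_leq_expn k : k`! <= k ^ k.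
Proof.
elim: k => // k IH; rewrite factS expnS leq_mul // (leq_trans IH) //.
by case: k {IH} => // k; rewrite leq_exp2r.
Qed.

(** The even permutations, half of all [(2 ^ n)!], lie in [F0 n] by [cost_even_perm], so each has a
    code for [decode]; there are at most [n ^ n * (n ^ 4) ^ L0 n] codes. *)
Lemma L0_lower m : 0 < m -> 4 ^ (2 ^ m.+1) <= n ->
  (2 ^ n.-1) ^ (2 ^ n.-1) <= 2 * n ^ (n + 4 * L0 n).
Proof.
move=> m0 mn.
have n2 : 1 < n.
  apply: leq_trans mn; have := @ltn_expl 4 (2 ^ m.+1) isT.
  by apply: leq_ltn_trans; rewrite expn_gt0.
have T1 : 1 < #|{: Z2 n}| by rewrite card_Z2 -[1]/(2 ^ 0) ltn_exp2l // ltnW.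
have -> : 2 * n ^ (n + 4 * L0 n) = 2 * (n ^ n * (n ^ 4) ^ L0 n).
  by rewrite expnD -expnM.
apply: (@leq_trans ((2 ^ n)`!)).
  by apply: leq_trans (expn_leq_fact _ _) _; rewrite addnn -mul2n -expnS prednK // ltnW.
rewrite -card_Z2 -card_Alt // leq_mul2l /=.
pose ff (g : {perm Z2 n}) : {ffun Z2 n -> Z2 n} := [ffun x => g x].
have ffI : injective ff.
  by move=> g h /ffunP e; apply/permP => x; have := e x; rewrite !ffunE.
rewrite -(card_imset _ ffI).
apply: leq_trans (_ : #|[set decode c | c : 'S_n * (L0 n).-tuple _]| <= _).
  apply/subset_leq_card/subsetP => _ /imsetP[g gA ->].
  have eg : ~~ odd_perm g by rewrite -Alt_even.
  have [S [cS _ rS]] := cost_even_perm m0 mn eg.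
  have iS : implements S (ff g).
    apply/existsP; exists 1%g; apply/forallP => x; apply/eqP/ffunP => i.
    by rewrite !ffunE perm1 rS.
  have fF : ff g \in F0 n by rewrite inE; apply/asboolP; exists S; rewrite cS.
  have [[S' [cS' iS' sS']] _] := Lf0_min fF.
  have [|c ->] := decodeP (L := L0 n) cS' iS'; last exact: imset_f.
  by rewrite sS' /L0; apply: (leq_bigmax_cond (F := @Lf0 n)).
rewrite (leq_trans (leq_imset_card _ _)) // card_prod card_Sn.
rewrite card_tuple card_option !card_prod card_ord leq_mul //.
  exact: fact_leq_expn.
case: (L0 n) => // l; rewrite leq_exp2r //; move: n2; rewrite !expnS; nia.
Qed.

End Lower.

(** * Choice of [m] and final estimates *)

Lemma encoding_width n : 256 <= n ->
  exists2 m, 0 < m & 4 ^ (2 ^ m.+1) <= n < 2 ^ (8 * 2 ^ m).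
Proof.
move=> n256; have n0 : 0 < n by apply: leq_trans n256.
have /andP[tn nt] := trunc_log_bounds (isT : 1 < 4) n0.
have t4 : 4 <= trunc_log 4 n by apply: trunc_log_max.
move: (trunc_log 4 n) tn nt t4 => t tn nt t4.
have t0 : 0 < t by apply: leq_trans t4.
have /andP[st ts] := trunc_log_bounds (isT : 1 < 2) t0.
have s2 : 2 <= trunc_log 2 t by apply: trunc_log_max.
(* The witness is one less than the rounded binary logarithm of [t]; it is positive because
   [256 <= n] forces [4 <= t]. *)
case: (trunc_log 2 t) st ts s2 => [//|[//|m]] st ts _.
exists m.+1 => //; apply/andP; split.
  by apply: leq_trans tn; rewrite leq_exp2l.
apply: leq_trans nt _; rewrite -[4]/(2 ^ 2) -expnM leq_exp2l //.
by move: ts; rewrite !expnS; lia.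
Qed.

(** Absorbs the lower order terms of the counting bound; [8 * n ^ 2] stands for [8 * n * log2 n]. *)
Lemma counting_slack n : 8 <= n ->
  n * 2 ^ n + 8 * n ^ 2 + 8 <= 8 * (n.-1 * 2 ^ n.-1).
Proof.
case: n => // n; rewrite ltnS => n7; rewrite /= expnS.
have : 8 * n.+1 <= 2 * 2 ^ n.
  elim: n n7 => // n IH; rewrite ltnS leq_eqVlt => /predU1P[<-//|/IH h].
  by rewrite expnS; move: h; move: (2 ^ n) => q; lia.
rewrite -mulnn; move: (2 ^ n) => q; nia.
Qed.

Local Open Scope ring_scope.
Import Order.TTheory GRing.Theory Num.Theory.

Theorem theorem7 (R : realType) :
  exists (c1 c2 : R) (n0 : nat),
    [/\ 0 < c1, 0 < c2 &
      forall n : nat, (n0 < n)%N ->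
        c1 * (n%:R * 2 ^+ n / log2 n%:R) <= (L0 n)%:R
          <= c2 * (n%:R * 2 ^+ n / log2 n%:R)].
Proof.
(* [5376 = 7 * 96 * 8]; in [1 / 32], a factor 8 is from [counting_slack] and 4 from the exponent
   [4 * L0 n]. *)
exists (1 / 32), 5376, 255%N; split=> [||n n256]; [lra|lra|].
have [m m0 /andP[mn nm]] := encoding_width n256.
have n8 : (8 <= n)%N by apply: leq_trans n256.
have n0 : 0 < n%:R :> R by rewrite ltr0n; apply: leq_trans n256.
have ln2 : 0 < ln 2 :> R by rewrite ln_gt0 // ltr1n.
have log2_le k : (n <= 2 ^ k)%N -> log2 (n%:R : R) <= k%:R.
  move=> nk; rewrite /log2 ler_pdivrMr // mulr_natl -lnXn // -natrX.
  by rewrite ler_ln ?posrE ?ler_nat // ltr0n expn_gt0.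
have lam0 : 0 < log2 (n%:R : R).
  by rewrite divr_gt0 // ln_gt0 // ltr1n; apply: leq_trans n256.
have lam_n : log2 (n%:R : R) <= n%:R by apply/log2_le/ltnW/ltn_expl.
have lam_m : log2 (n%:R : R) <= (8 * 2 ^ m)%:R by apply/log2_le/ltnW.
rewrite !mulrA ler_pdivrMr // ler_pdivlMr //; apply/andP; split.
  have := L0_lower m0 mn; rewrite -expnM => le.
  have {le} : ((n.-1 * 2 ^ n.-1)%:R * ln 2 <=
      ln 2 + (n + 4 * L0 n)%:R * ln n%:R :> R).
    rewrite !mulr_natl -!lnXn // -lnM ?posrE ?exprn_gt0 // -!natrX -natrM.
    by rewrite ler_ln ?posrE ?ler_nat // ltr0n ?muln_gt0 ?expn_gt0 ?(leq_trans _ n8).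
  have -> : ln n%:R = log2 n%:R * ln 2 :> R by rewrite /log2 divfK // gt_eqF.
  rewrite mulrA -{2}[ln 2]mul1r -mulrDl ler_pM2r //.
  have := counting_slack n8; rewrite -(ler_nat R) !natrD !natrM !natrX.
  move: lam_n lam0 n0; move: (log2 _) => lam.
  have := ler0n R (L0 n); move: (L0 n)%:R n%:R => l r.
  nra.
have L := L0_upper m0 mn.
(* The bound [log2 n <= 8 * 2 ^ m] turns [2 ^ (n - m)] into [2 ^ n]. *)
have : (L0 n)%:R * log2 n%:R <= (7 * 96 * n * 2 ^ (n - m))%:R * (8 * 2 ^ m)%:R :> R.
  by apply: ler_pM; rewrite ?ler0n ?ler_nat // ltW.
move=> /le_trans; apply; rewrite -!natrM -natrX -!natrM ler_nat.
have -> : (2 ^ n = 2 ^ (n - m) * 2 ^ m)%N.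
  rewrite -expnD subnK // (leq_trans _ mn) //.
  have /ltnW := @ltn_expl 4 (2 ^ m.+1) isT; apply: leq_trans.
  by rewrite (leq_trans (leqnSn m)) // ltnW // ltn_expl.
nia.
Qed.
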